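(* Let $\Gamma$ be an infinite set and let $K$ be a compact Hausdorff space containing an infinite set of isolated points of $K$ which has a unique limit point in $K$. Then $m(\ell_\infty(\Gamma))=m(C(K))=\omega$.
   Context: $\ell_\infty(\Gamma)$ is the Banach space of bounded real functions on $\Gamma$ with the supremum norm; $C(K)$ is the Banach space of continuous real functions on $K$ with the supremum norm. A subset $S$ of a metric space $(M,d)$ is equilateral if there is $\lambda>0$ with $d(x,y)=\lambda$ for all distinct $x,y\in S$. An equilateral set $A\subseteq M$ is maximal if there is no equilateral set $B\subseteq M$ with $A\subsetneq B$. $m(M)=\min\{|A|: A \text{ is a maximal equilateral set in } M\}$ (a cardinal). A normed space is regarded as a metric space via its norm. *)

(* Defs.v *)
(* MathComp / MathComp-Analysis. *)
From HB Require Import structures.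
From mathcomp Require Import all_boot all_order all_algebra.
From mathcomp Require Import all_classical all_reals.
From mathcomp Require Import topology normedtype.

Set Implicit Arguments.
Unset Strict Implicit.
Unset Printing Implicit Defensive.

Import Order.TTheory GRing.Theory Num.Theory.
Import numFieldNormedType.Exports.

Local Open Scope classical_set_scope.
Local Open Scope ring_scope.

Section Equilateral.
Context {R : realType} {M : metricType R}.

Definition equilateral (S : set M) : Prop :=
  exists2 lam : R, 0 < lam &
    forall x y, S x -> S y -> x <> y -> mdist x y = lam.

Definition maximal_equilateral (A : set M) : Prop :=
  equilateral A /\ ~ exists B : set M, equilateral B /\ A `<` B.

End Equilateral.

(* [min_maximal_equilateral M C] says that m(M) is the cardinal of [C].
   Cardinals are not objects of the library, so the minimum is stated through
   comparison of cardinals: |C| is attained by a maximal equilateral set, and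
   is a lower bound for all of them. *)
Definition min_maximal_equilateral {R : realType} (M : metricType R)
    {T : Type} (C : set T) : Prop :=
  (exists A : set M, maximal_equilateral A /\ (A #= C)%card) /\
  (forall A : set M, maximal_equilateral A -> (C #<= A)%card).

(* [sup set0 = 0], so this is also the right norm when [T] is empty. *)
Definition sup_norm {R : realType} {T : Type} (f : T -> R) : R :=
  sup [set `|f x| | x in [set: T]].

Section SupNorm.
Context {R : realType} {T : Type}.
Implicit Types f g : T -> R.

Lemma sup_norm_ub f x : bounded_fun f -> `|f x| <= sup_norm f.
Proof.
move=> bf; apply: ub_le_sup; last by exists x.
case: bf => M [_ bM]; exists (M + 1) => _ [y _ <-].
by apply: bM => //; rewrite ltrDl.
Qed.

Lemma sup_norm_ge0 f : 0 <= sup_norm f.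
Proof.
rewrite /sup_norm; set E := (X in sup X).
have [sE|/sup_out->//] := pselect (has_sup E).
have [_ [x _ _]] := sE.1; rewrite (le_trans (normr_ge0 (f x)))//.
by apply: ub_le_sup; [exact: sE.2|exists x].
Qed.

Lemma sup_norm_le f c : 0 <= c -> (forall x, `|f x| <= c) -> sup_norm f <= c.
Proof.
move=> c0 fc; rewrite /sup_norm.
have [->|/set0P ne] := eqVneq [set `|f x| | x in [set: T]] set0.
  by rewrite sup0.
by apply: ge_sup => // _ [x _ <-].
Qed.

Lemma ler_sup_normD f g : bounded_fun f -> bounded_fun g ->
  sup_norm (f \+ g) <= sup_norm f + sup_norm g.
Proof.
move=> bf bg; apply: sup_norm_le => [|x]; first by rewrite addr_ge0 ?sup_norm_ge0.
by rewrite (le_trans (ler_normD _ _))// lerD// sup_norm_ub.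
Qed.

Lemma bounded_funZ (a : R) f : bounded_fun f -> bounded_fun (a \*: f).
Proof.
move=> bf; exists (`|a| * sup_norm f); split; first exact: num_real.
move=> M ltM x _ /=; rewrite (le_trans _ (ltW ltM))// normrM.
by rewrite ler_wpM2l// sup_norm_ub.
Qed.

Lemma sup_normZ (a : R) f : bounded_fun f ->
  sup_norm (a \*: f) = `|a| * sup_norm f.
Proof.
have le b g : bounded_fun g -> sup_norm (b \*: g) <= `|b| * sup_norm g.
  move=> bg; apply: sup_norm_le => [|x]; first by rewrite mulr_ge0 ?sup_norm_ge0.
  by rewrite /= normrM ler_wpM2l// sup_norm_ub.
move=> bf; apply/eqP; rewrite eq_le le//=.
have [->|a0] := eqVneq a 0; first by rewrite normr0 mul0r sup_norm_ge0.
rewrite -ler_pdivlMl ?normr_gt0// -normfV.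
have -> : sup_norm f = sup_norm (a^-1 \*: (a \*: f)).
  by congr sup_norm; apply/funext => x /=; rewrite scalerA mulVf// scale1r.
by apply: le; exact: bounded_funZ.
Qed.

Lemma sup_norm0_eq0 f : bounded_fun f -> sup_norm f = 0 -> f = 0.
Proof.
move=> bf f0; apply/funext => x; apply/normr0_eq0/eqP.
by rewrite eq_le normr_ge0 -f0 sup_norm_ub.
Qed.

End SupNorm.

Section MetricOfNorm.
Context {R : realType} (V : normedModType R).

Definition norm_dist (x y : V) : R := `|x - y|.

Lemma norm_dist_ge0 x y : 0 <= norm_dist x y.
Proof. exact: normr_ge0. Qed.

Lemma norm_dist_positivity x y : norm_dist x y = 0 -> x = y.
Proof. by move/normr0_eq0/subr0_eq. Qed.

Lemma ballE_norm_dist (x : V) (d : R) : ball x d = [set y | norm_dist x y < d].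
Proof. by rewrite -ball_normE. Qed.

End MetricOfNorm.

Section EllInfty.
Context (R : realType) (Gamma : Type).

Definition bounded_pred : {pred Gamma -> R} :=
  mem (bounded_fun : set (Gamma -> R)).

Record ell_infty := EllInfty {
  ell_infty_fun :> Gamma -> R ;
  _ : ell_infty_fun \in bounded_pred }.

HB.instance Definition _ := [isSub for ell_infty_fun].
HB.instance Definition _ := [Choice of ell_infty by <:].

Lemma bounded_submod_closed : submod_closed bounded_pred.
Proof.
split=> [|a f g /set_mem bf /set_mem bg]; apply/mem_set.
  by exists 0; split=> // M /ltW M0 x _; rewrite /= normr0.
by apply: (bounded_funD _ bg); exact: bounded_funZ.
Qed.

HB.instance Definition _ :=
  GRing.isSubmodClosed.Build _ _ bounded_pred bounded_submod_closed.
HB.instance Definition _ := [SubChoice_isSubLmodule of ell_infty by <:].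

Lemma ell_infty_bounded (f : ell_infty) : bounded_fun (f : Gamma -> R).
Proof. by case: f => f /= /set_mem. Qed.

Definition ell_infty_norm (f : ell_infty) : R := sup_norm f.

Lemma ler_ell_infty_normD f g :
  ell_infty_norm (f + g) <= ell_infty_norm f + ell_infty_norm g.
Proof. exact: ler_sup_normD (ell_infty_bounded f) (ell_infty_bounded g). Qed.

Lemma ell_infty_normZ (a : R) f :
  ell_infty_norm (a *: f) = `|a| * ell_infty_norm f.
Proof. exact: sup_normZ (ell_infty_bounded f). Qed.

Lemma ell_infty_norm0_eq0 f : ell_infty_norm f = 0 -> f = 0.
Proof. by move=> f0; apply/val_inj/(sup_norm0_eq0 (ell_infty_bounded f)). Qed.

HB.instance Definition _ := Lmodule_isNormed.Build R ell_infty
  ler_ell_infty_normD ell_infty_normZ ell_infty_norm0_eq0.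

HB.instance Definition _ := PseudoMetric_isMetric.Build R ell_infty
  (@norm_dist_ge0 R ell_infty) (@norm_dist_positivity R ell_infty)
  (@ballE_norm_dist R ell_infty).

End EllInfty.

(* The compactness proof [cK] is a parameter of the type [C_space R cK]: the
   norm axioms need the elements to be bounded, which follows from [cK]. *)
Section ContinuousFunctions.
Context (R : realType) (K : topologicalType) (cK : compact [set: K]).

Definition continuous_pred : {pred K -> R} :=
  mem [set f : K -> R | continuous f].

Record C_space_of (cK : compact [set: K]) := CSpace {
  C_space_fun :> K -> R ;
  _ : C_space_fun \in continuous_pred }.

Local Notation C_space := (C_space_of cK).

HB.instance Definition _ := [isSub for @C_space_fun cK].
HB.instance Definition _ := [Choice of C_space by <:].

Lemma continuous_submod_closed : submod_closed continuous_pred.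
Proof.
split=> [|a f g /set_mem cf /set_mem cg]; apply/mem_set => x.
  exact: cst_continuous.
by apply: continuousD (cg x); apply: continuousZr; exact: cf.
Qed.

HB.instance Definition _ :=
  GRing.isSubmodClosed.Build _ _ continuous_pred continuous_submod_closed.
HB.instance Definition _ := [SubChoice_isSubLmodule of C_space by <:].

Lemma C_space_continuous (f : C_space) : continuous (f : K -> R).
Proof. by case: f => f /= /set_mem. Qed.

Lemma C_space_bounded (f : C_space) : bounded_fun (f : K -> R).
Proof.
have : compact ((f : K -> R) @` [set: K]).
  apply: continuous_compact => //.
  by apply: continuous_subspaceT; exact: C_space_continuous.
move/compact_bounded => [M [Mr bM]]; exists M; split=> // N MN x _.
by apply: bM MN _ _; exists x.
Qed.

Definition C_space_norm (f : C_space) : R := sup_norm f.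

Lemma ler_C_space_normD f g :
  C_space_norm (f + g) <= C_space_norm f + C_space_norm g.
Proof. exact: ler_sup_normD (C_space_bounded f) (C_space_bounded g). Qed.

Lemma C_space_normZ (a : R) f : C_space_norm (a *: f) = `|a| * C_space_norm f.
Proof. exact: sup_normZ (C_space_bounded f). Qed.

Lemma C_space_norm0_eq0 f : C_space_norm f = 0 -> f = 0.
Proof. by move=> f0; apply/val_inj/(sup_norm0_eq0 (C_space_bounded f)). Qed.

HB.instance Definition _ := Lmodule_isNormed.Build R C_space
  ler_C_space_normD C_space_normZ C_space_norm0_eq0.

HB.instance Definition _ := PseudoMetric_isMetric.Build R C_space
  (@norm_dist_ge0 R C_space) (@norm_dist_positivity R C_space)
  (@ballE_norm_dist R C_space).

End ContinuousFunctions.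

Notation C_space R cK := (@C_space_of R _ cK).

(* Main.v *)
(* Every finite equilateral set A can be enlarged: at a point y (isolated, in the
   case of C(K)) on which no distance within A depends, lower the member of A
   that is largest at y by the common distance.

   Conversely, fix a sequence s_i of distinct points, converging to p in the case
   of C(K), and let f_n equal i mod 2 at s_i for i < n, 1 - (n mod 2) at s_n, and
   a constant c_n in ]0, 1[ elsewhere, where c_n accumulates at 0 and at 1. The
   f_n are at mutual distance 1. A function h at distance 1 from all of them has
   values in [0, 1], so only the points s_0, ..., s_n can realise its distance to
   f_n, and inductively h(s_n) = n mod 2. No such h is continuous at p; in
   l_infty, adding i mod 2 at s_i and 1/2 elsewhere makes the set maximal. *)
Require Import Defs.
From mathcomp Require Import all_boot all_order all_algebra.
From mathcomp Require Import all_classical all_reals.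
From mathcomp Require Import topology normedtype.
From mathcomp Require Import lra.

Set Implicit Arguments.
Unset Strict Implicit.
Unset Printing Implicit Defensive.

Import Order.TTheory GRing.Theory Num.Theory.
Import numFieldNormedType.Exports.

Local Open Scope classical_set_scope.
Local Open Scope ring_scope.

(** * Supremum metrics, the common setting of both spaces *)

Record sup_metric {R : realType} {M : metricType R} {T : Type}
    (ev : M -> T -> R) : Prop := SupMetric {
  sup_metric_bounded : forall f g, bounded_fun (fun x => ev f x - ev g x) ;
  sup_metricE : forall f g, mdist f g = sup_norm (fun x => ev f x - ev g x) }.

Section SupMetric.
Context {R : realType} {M : metricType R} {T : Type} {ev : M -> T -> R}.
Hypothesis evM : sup_metric ev.

Lemma ler_dist_mdist f g x : `|ev f x - ev g x| <= mdist f g.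
Proof. by rewrite (sup_metricE evM) (sup_norm_ub x (sup_metric_bounded evM f g)). Qed.

Lemma mdist_le f g c : 0 <= c -> (forall x, `|ev f x - ev g x| <= c) ->
  mdist f g <= c.
Proof. by move=> c0 fgc; rewrite (sup_metricE evM) sup_norm_le. Qed.

Lemma lt_mdist_ex f g c : 0 <= c -> c < mdist f g ->
  exists x, c < `|ev f x - ev g x|.
Proof.
move=> c0 cfg; apply: contrapT => /forallNP fgc; move: cfg; rewrite ltNge => /negP; apply.
by apply: mdist_le => // x; rewrite leNgt; apply/negP/fgc.
Qed.

(* Either the supremum is attained at [x], or it is not attained and removing
   any single point leaves it unchanged. *)
Lemma mdist_off_point f g : 0 < mdist f g ->
  exists x, forall y, y <> x -> forall c, 0 <= c -> c < mdist f g ->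
    exists2 z, z <> y & c < `|ev f z - ev g z|.
Proof.
move=> fg0.
have [[x fgx]|/forallNP nfg] :=
  pselect (exists x, `|ev f x - ev g x| = mdist f g).
  by exists x => y yx c c0 cfg; exists x; [exact: nesym|rewrite fgx].
have [x _] := lt_mdist_ex (lexx 0) fg0.
exists x => y _ c c0 cfg.
have yfg : `|ev f y - ev g y| < mdist f g.
  by rewrite lt_neqAle ler_dist_mdist andbT; apply/eqP.
have [||z] := @lt_mdist_ex f g (Num.max c `|ev f y - ev g y|).
- by rewrite le_max c0.
- by rewrite gt_max cfg.
- by rewrite gt_max => /andP[cz yz]; exists z => // zy; rewrite zy ltxx in yz.
Qed.

End SupMetric.

(** * Enlarging finite equilateral sets *)

Lemma finite_argmax {R : realType} {M : choiceType} (A : set M) (u : M -> R) :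
  finite_set A -> A !=set0 -> exists2 f, A f & forall g, A g -> u g <= u f.
Proof.
move=> /finite_seqP[s ->]; elim: s => [[]//|f s ih _].
have [->|] := eqVneq s [::].
  by exists f => [|g]; rewrite /= inE// => /eqP ->.
case: s ih => // f' s ih _.
have [|g gs gmax] := ih; first by exists f' => /=; rewrite mem_head.
have [fg|/ltW gf] := leP (u f) (u g).
  exists g => [|k]; first by rewrite /= inE orbC [g \in _]gs.
  by rewrite /= inE => /orP[/eqP->//|/gmax].
exists f => [|k]; first by rewrite /= mem_head.
by rewrite /= inE => /orP[/eqP->//|/gmax kg]; exact: le_trans gf.
Qed.

(** [D] collects points where a single value can be changed without leaving the space: all of
    [Gamma], or isolated points of [K]. The element [m0] enlarges the empty set. *)
Lemma maximal_equilateral_infinite {R : realType} {M : metricType R} {T : Type}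
    (ev : M -> T -> R) (m0 : M) (D : set T) (A : set M) :
  sup_metric ev -> infinite_set D ->
  (forall f y c, D y -> exists g,
    ev g y = ev f y - c /\ forall x, x <> y -> ev g x = ev f x) ->
  maximal_equilateral A -> infinite_set A.
Proof.
move=> evM Dinf perturb [[lam lam0 eqA] maxA] Afin; apply: maxA.
have [A0|/set0P Ane] := eqVneq A set0.
  exists [set m0]; split; first by exists 1 => // x y -> ->.
  by rewrite A0; split=> // /(_ m0 erefl).
have [t0 _] := infinite_setN0 Dinf.
(* [J] gives each pair of distinct members of [A] its exceptional point; [t0] is a dummy value for
   all other pairs. *)
have /choice[J JP] : forall fg : M * M, exists x, A fg.1 -> A fg.2 ->
    fg.1 <> fg.2 -> forall y, y <> x -> forall c, 0 <= c -> c < lam ->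
    exists2 z, z <> y & c < `|ev fg.1 z - ev fg.2 z|.
  move=> [f g] /=.
  have [[[Af Ag] fg]|nfg] := pselect ((A f /\ A g) /\ f <> g); last first.
    by exists t0 => Af Ag fg; case: nfg.
  have := @mdist_off_point _ _ _ _ evM f g.
  by rewrite eqA// => /(_ lam0)[x xP]; exists x.
have [y [Dy Jy]] : (D `\` J @` (A `*` A)) !=set0.
  apply: infinite_setN0; apply: infinite_setD => //.
  by apply: finite_image; exact: finite_setX.
(* By maximality f0(y) - f(y) lies in [0, lam] for every f in [A], so lowering f0 by lam at y leaves
   a difference in [-lam, 0]. *)
have [f0 Af0 f0max] := finite_argmax (ev^~ y) Afin Ane.
have [h [hy hE]] := perturb f0 y lam Dy.
have hf f : A f -> mdist h f = lam.
  move=> Af; apply/eqP; rewrite eq_le; apply/andP; split.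
    apply: (mdist_le evM) (ltW lam0) _ => x.
    have [->|xy] := pselect (x = y).
      rewrite hy.
      have := ler_dist_mdist evM f0 f y; have := f0max _ Af.
      have [->|/eqP f0f] := eqVneq f0 f; first by move=> *; rewrite ler_norml; lra.
      by rewrite eqA// ler_norml => ? /andP[? ?]; rewrite ler_norml; lra.
    rewrite hE//; have := ler_dist_mdist evM f0 f x.
    have [->|/eqP f0f] := eqVneq f0 f; last by rewrite eqA.
    by rewrite subrr normr0 => _; exact: ltW.
  have [<-|/eqP f0f] := eqVneq f0 f.
    have := ler_dist_mdist evM h f0 y; rewrite hy.
    by rewrite addrAC subrr sub0r normrN gtr0_norm.
  (* Away from y, [h] agrees with [f0]; since y is not exceptional for (f0, f), differences
     arbitrarily close to lam survive there. *)
  rewrite leNgt; apply/negP => hlam.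
  have yJ : y <> J (f0, f) by move=> yE; apply: Jy; exists (f0, f).
  have [z zy] := JP (f0, f) Af0 Af f0f y yJ _ (mdist_ge0 h f) hlam.
  have := ler_dist_mdist evM h f z.
  by rewrite hE// leNgt => /negP.
have nAh : ~ A h.
  by move=> /hf; rewrite mdistxx => lamE; rewrite -lamE ltxx in lam0.
exists (A `|` [set h]); split.
  exists lam => // f g [Af|->] [Ag|->] // fg; first exact: eqA.
  - by rewrite metric_sym hf.
  - exact: hf.
by split=> [f|/(_ h (or_intror erefl))//]; left.
Qed.

(** Two distinct members force every equilateral extension to have common distance 1, so a new point
    would be at distance 1 from all of [A]. *)
Lemma maximal_equilateral_unit {R : realType} {M : metricType R} (A : set M) :
  (exists f g, [/\ A f, A g & f <> g]) ->
  (forall f g, A f -> A g -> f <> g -> mdist f g = 1) ->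
  (forall h, ~ forall f, A f -> mdist h f = 1) -> maximal_equilateral A.
Proof.
move=> [f [g [Af Ag fg]]] eqA noh; split; first by exists 1.
move=> [B [[lam lam0 eqB] [AB /existsNP[h /not_implyP[Bh nAh]]]]].
apply: (noh h) => k Ak.
have lam1 : lam = 1 by rewrite -(eqA _ _ Af Ag fg) eqB//; exact: AB.
by rewrite -lam1; apply: eqB => //; [exact: AB|move=> hk; apply: nAh; rewrite hk].
Qed.

Lemma min_maximal_equilateral_nat {R : realType} {M : metricType R}
    (A : set M) : (forall B : set M, maximal_equilateral B -> infinite_set B) ->
  maximal_equilateral A -> countable A ->
  min_maximal_equilateral M [set: nat].
Proof.
move=> infB maxA cA; split; last by move=> B /infB/infiniteP.
by exists A; split=> //; apply: eq_card_nat => //; exact: infB.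
Qed.

(** * A sequence of functions at mutual distance 1 *)

Section DeviatingWords.
Context {R : realType}.

Definition parity (i : nat) : R := if odd i then 1 else 0.

(** The shift by two keeps the gap at most 1/2; a tail in [gap, 1 - gap] is then at distance at most
    1 - gap < 1 from every point of [0, 1]. *)
Definition word_gap (n : nat) : R := n.+2%:R^-1.

Definition word_tail (n : nat) : R :=
  if odd n then word_gap n else 1 - word_gap n.

(** The value of f_n at s_i, with [word_tail n] as the constant c_n. *)
Definition word (n i : nat) : R :=
  if (i < n)%N then parity i
  else if i == n then 1 - parity i else word_tail n.


Lemma word_ltn n i : (i < n)%N -> word n i = parity i.
Proof. by rewrite /word => ->. Qed.

Lemma word_diag n : word n n = 1 - parity n.
Proof. by rewrite /word ltnn eqxx. Qed.

Lemma word_gtn n i : (n < i)%N -> word n i = word_tail n.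
Proof. by move=> ni; rewrite /word ltnNge ltnW//= gtn_eqF. Qed.

Lemma word_gap_itv n : 0 < word_gap n <= 2^-1.
Proof. by rewrite invr_gt0 ltr0n lef_pV2 ?posrE// ler_nat. Qed.

Lemma word_tail_itv n : word_gap n <= word_tail n <= 1 - word_gap n.
Proof.
have := word_gap_itv n.
by rewrite /word_tail; case: ifP => _; lra.
Qed.

Lemma word_itv n i : 0 <= word n i <= 1.
Proof.
have := word_tail_itv n; have := word_gap_itv n.
by rewrite /word /parity; case: (i < n)%N; case: (i == n); case: (odd i); lra.
Qed.

(** Even tails tend to 1 and bound a below by 0; odd tails tend to 0 and bound it above by 1. *)
Lemma unit_dist_word_tail_itv (a : R) :
  (forall n, `|a - word_tail n| <= 1) -> 0 <= a <= 1.
Proof.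
move=> an.
have small e : 0 < e -> word_gap (Num.truncn e^-1).*2 < e /\
    word_gap (Num.truncn e^-1).*2.+1 < e.
  move=> e0; have e1 : e^-1 < (Num.truncn e^-1).+1%:R by exact: truncnS_gt.
  by split; rewrite /word_gap -[ltRHS]invrK ltf_pV2 ?posrE ?invr_gt0//;
    apply: lt_le_trans e1 _; rewrite ler_nat -addnn ?ltnS ?leqW// leq_addr.
apply/andP; split; rewrite leNgt; apply/negP => a0.
  have [|+ _] := small (- a); first by rewrite oppr_gt0.
  have := an (Num.truncn (- a)^-1).*2.
  by rewrite /word_tail odd_double ler_norml; lra.
have [|_] := small (a - 1); first by rewrite subr_gt0.
have := an (Num.truncn (a - 1)^-1).*2.+1.
by rewrite /word_tail /= odd_double/= ler_norml; lra.
Qed.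

Context {M : metricType R} {T : Type} {ev : M -> T -> R}.
Variables (s : nat -> T) (r : T -> option nat) (f : nat -> M).
Hypothesis evM : sup_metric ev.
Hypothesis rs : forall x i, r x = Some i <-> x = s i.
Hypothesis fE : forall n x, ev (f n) x = oapp (word n) (word_tail n) (r x).

Let f_s n i : ev (f n) (s i) = word n i.
Proof. by rewrite fE (rs (s i) i).2. Qed.

Lemma ev_word_itv n x : 0 <= ev (f n) x <= 1.
Proof.
rewrite fE; case: (r x) => [i|] /=; first exact: word_itv.
have := word_tail_itv n; have := word_gap_itv n.
by lra.
Qed.

(** For m < n the distance is attained at s_m, where f_m deviates from the parity pattern and f_n
    still follows it. *)
Lemma mdist_word m n : m <> n -> mdist (f m) (f n) = 1.
Proof.
wlog mn : m n / (m < n)%N => [wl|_].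
  by move=> /eqP; rewrite neq_ltn => /orP[|] mn; [|rewrite metric_sym];
    apply: wl => //; apply/eqP; rewrite ltn_eqF.
apply/eqP; rewrite eq_le; apply/andP; split.
  apply: (mdist_le evM) => // x; rewrite ler_norml.
  by have := ev_word_itv m x; have := ev_word_itv n x; lra.
have := ler_dist_mdist evM (f m) (f n) (s m).
rewrite !f_s word_diag word_ltn//; apply: le_trans.
by rewrite ler_normr /parity; case: (odd m); lra.
Qed.

Section AtUnitDistance.
Variable h : M.
Hypothesis hf : forall n, mdist h (f n) = 1.

Lemma unit_dist_itv x : 0 <= ev h x <= 1.
Proof.
have hfx n := ler_dist_mdist evM h (f n) x.
case rx : (r x) => [i|]; last first.
  apply: unit_dist_word_tail_itv => n; rewrite -(hf n).
  by have := hfx n; rewrite fE rx.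
(* At s_i the functions f_i and f_(i+1) take the values 0 and 1 in some order. *)
have := hfx i; have := hfx i.+1.
rewrite !hf !fE rx /= word_diag word_ltn// !ler_norml /parity.
by case: (odd i); lra.
Qed.

Lemma unit_dist_parity n : ev h (s n) = parity n.
Proof.
elim/ltn_ind: n => n ih; apply: contrapT => hn.
have n0 := word_gap_itv n.
pose b := `|ev h (s n) - (1 - parity n)|.
have b1 : b < 1.
  have := unit_dist_itv (s n); move: hn; rewrite /b ltr_norml /parity.
  by case: (odd n) => /eqP; rewrite neq_lt => /orP[|]; lra.
(* The difference vanishes at s_i for i < n by induction, is [b] at s_n, and is at most 1 - gap
   everywhere else; so the distance would be below 1. *)
suff : mdist h (f n) <= Num.max b (1 - word_gap n).
  by rewrite hf le_max [1 <= b]leNgt b1/=; lra.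
have tail x : `|ev h x - word_tail n| <= Num.max b (1 - word_gap n).
  rewrite le_max; apply/orP; right; rewrite ler_norml.
  by have := unit_dist_itv x; have := word_tail_itv n; lra.
apply: (mdist_le evM) => [|x]; first by rewrite le_max normr_ge0.
rewrite fE; case rx : (r x) => [i|] //=.
have [ni|ni|ni] := ltngtP n i; first by rewrite word_gtn.
  by rewrite word_ltn// ((rs x i).1 rx) ih// subrr normr0 le_max normr_ge0.
by rewrite -ni word_diag (rs x n).1 ?ni// -ni le_max lexx.
Qed.

End AtUnitDistance.

End DeviatingWords.

(** * Sequences, isolated points and limit points *)

Lemma partial_inverse {T : Type} (s : nat -> T) : injective s ->
  exists r : T -> option nat, forall x i, r x = Some i <-> x = s i.
Proof.
move=> sI; exists (fun x =>
  if pselect (exists i, x = s i) is left e then Some (projT1 (cid e)) else None).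
move=> x i; case: pselect => [e|ne]; last by split=> // xi; case: ne; exists i.
case: cid => j /= xj; split=> [[<-]//|xi]; congr Some.
by apply: sI; rewrite -xj.
Qed.

Lemma infinite_set_injection {T : Type} (S : set T) : infinite_set S ->
  exists2 s : nat -> T, injective s & forall n, S (s n).
Proof.
move=> /infiniteP/card_leP[u].
exists (fun n => val (u (to_setT n))) => [m n /val_inj uE|n]; last exact: set_valP.
by have /(congr1 val) := inj (mem_set I) (mem_set I) uE.
Qed.

(** The function is locally constant: points of [F] are isolated, and the complement of the finite
    set [F] is open. *)
Lemma continuous_off_isolated {R : realType} {K : topologicalType} (F : set K)
    (g : K -> R) (c : R) : hausdorff_space K -> finite_set F ->
  F `<=` isolated [set: K] -> (forall x, ~ F x -> g x = c) -> continuous g.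
Proof.
move=> hK finF isoF gc x; apply: cvg_near_cst.
have [/isoF[_ [V xV]]|nFx] := pselect (F x).
  by rewrite setIT => Vx; apply: filterS xV => z; rewrite Vx => ->.
have : nbhs x (~` F).
  apply: open_nbhs_nbhs; split=> //; apply: closed_openC.
  by move/hausdorff_accessible/accessible_finite_set_closed : hK; exact.
by apply: filterS => z nFz; rewrite !gc.
Qed.

(** A cluster point q of the sequence works: by injectivity [t] takes the value q at most once, so
    late terms near q differ from q. *)
Lemma compact_limit_point {K : topologicalType} (t : nat -> K) :
  compact [set: K] -> injective t -> limit_point (range t) !=set0.
Proof.
move=> cK tI; have [q [_ tq]] := cK (t @ \oo) _ filterT.
exists q => U qU; apply: contrapT => nU.
have tU n : U (t n) -> t n = q.
  by move=> Utn; apply: contrapT => tnq; apply: nU; exists (t n); split=> //; apply/eqP.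
have [N NP] : exists N, forall n, (N <= n)%N -> t n <> q.
  have [[m tm]|/forallNP nt] := pselect (exists m, t m = q); last by exists 0%N.
  by exists m.+1 => n mn; rewrite -tm => /tI nm; rewrite nm ltnn in mn.
have tN : (t @ \oo) (t @` [set n | (N <= n)%N]).
  by exists N => // n Nn; exists n.
by have [_ [[n Nn <-] /tU]] := tq _ _ tN qU; exact: NP.
Qed.

Lemma limit_pointS {K : topologicalType} (A B : set K) :
  A `<=` B -> limit_point A `<=` limit_point B.
Proof. by move=> AB q qA U /qA[y [yq /AB By Uy]]; exists y. Qed.

Lemma limit_point_cst {R : realType} {K : topologicalType} (h : K -> R) (A : set K)
    (c : R) (q : K) :
  continuous h -> (forall x, A x -> h x = c) -> limit_point A q -> h q = c.
Proof.
move=> /continuous_closedP hc hA /subset_limit_point Aq.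
have hc1 : closed (h @^-1` [set x | x = c]) by apply: hc; exact: closed_eq.
by apply: hc1; exact: closureS Aq.
Qed.

(** * The case of bounded functions *)

Section EllInfty.
Context (R : realType) (Gamma : Type).

Lemma ell_infty_sup_metric : sup_metric (@ell_infty_fun R Gamma).
Proof. by split=> // f g; exact: (ell_infty_bounded (f - g)). Qed.

Lemma ell_infty_ex (g : Gamma -> R) (c : R) : (forall x, `|g x| <= c) ->
  exists f : ell_infty R Gamma, forall x, f x = g x.
Proof.
move=> gc; have bg : bounded_fun g.
  by exists c; split=> [|M cM x _]; [exact: num_real|exact: le_trans (gc x) (ltW cM)].
by exists (EllInfty (mem_set bg)).
Qed.

Lemma ell_infty_min_maximal_equilateral : infinite_set [set: Gamma] ->
  min_maximal_equilateral (ell_infty R Gamma) [set: nat].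
Proof.
move=> Ginf; have evM := ell_infty_sup_metric.
have [s sI _] := infinite_set_injection Ginf.
have [r rs] := partial_inverse sI.
have /choice[f fE] : forall n, exists f : ell_infty R Gamma,
    forall x, f x = oapp (word n) (word_tail n) (r x).
  move=> n; apply: (@ell_infty_ex _ 1) => x.
  rewrite ler_norml; case: (r x) => [i|] /=.
    by have := @word_itv R n i; lra.
  by have := @word_gap_itv R n; have := @word_tail_itv R n; lra.
have [foo fooE] : exists foo : ell_infty R Gamma,
    forall x, foo x = oapp parity 2^-1 (r x).
  apply: (@ell_infty_ex _ 1) => x.
  by rewrite ler_norml; case: (r x) => [i|] /=; rewrite /parity; try case: (odd i); lra.
have foof n : mdist foo (f n) = 1.
  apply/eqP; rewrite eq_le; apply/andP; split.
    apply: (mdist_le evM) => // x; have := ev_word_itv fE n x.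
    by rewrite fooE ler_norml; case: (r x) => [i|] /=;
      rewrite /parity; try case: (odd i); lra.
  have := ler_dist_mdist evM foo (f n) (s n).
  rewrite fooE fE (rs (s n) n).2//= word_diag; apply: le_trans.
  by rewrite ler_normr /parity; case: (odd n); lra.
apply: (@min_maximal_equilateral_nat _ _ (foo |` range f)).
- move=> B; apply: (maximal_equilateral_infinite (0 : ell_infty R Gamma) evM Ginf) => g y c _.
  have [d dE] : exists d : ell_infty R Gamma,
      forall x, d x = if `[< x = y >] then c else 0.
    by apply: (@ell_infty_ex _ `|c|) => x; case: asboolP; rewrite ?normr0.
  exists (g - d); split=> [|x xy].
    by transitivity (g y - d y); rewrite // dE; case: asboolP.
  by transitivity (g x - d x); rewrite // dE; case: asboolP => // _; rewrite subr0.
- apply: maximal_equilateral_unit.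
  + exists foo, (f 0%N); split; [by left|by right; exists 0%N|] => foof0.
    by have := foof 0%N; rewrite foof0 mdistxx => /eqP; rewrite eq_sym oner_eq0.
  + move=> _ _ [->|[m _ <-]] [->|[n _ <-]]// mn; first by rewrite metric_sym.
    by apply: (mdist_word evM rs fE) => mnE; apply: mn; rewrite mnE.
  + move=> h hA; have hf n : mdist h (f n) = 1 by apply: hA; right; exists n.
    have := hA foo (or_introl erefl).
    (* [h] equals [foo] on the sequence, and elsewhere takes values in [0, 1], within 1/2 of the
       value of [foo]. *)
    suff : mdist h foo <= 2^-1 by move=> + hfoo; rewrite hfoo; lra.
    apply: (mdist_le evM) => [|x]; first by rewrite invr_ge0.
    rewrite fooE; case rx : (r x) => [i|] /=.
      rewrite ((rs x i).1 rx) (unit_dist_parity evM rs fE hf) subrr normr0; lra.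
    by rewrite ler_norml; have := unit_dist_itv evM fE hf x; lra.
- have -> : foo |` range f = range (oapp f foo).
    apply/seteqP; split=> [_ [->|[n _ <-]]|_ [[n|] _ <-]] /=.
    + by exists None.
    + by exists (Some n).
    + by right; exists n.
    + by left.
  exact: sub_countable (card_image_le _ _) (countableP _).
Qed.

End EllInfty.

(** * The case of continuous functions *)

Section ContinuousFunctions.
Context (R : realType) (K : topologicalType) (cK : compact [set: K]).

Lemma C_space_sup_metric : sup_metric (@C_space_fun R K cK).
Proof. by split=> // f g; exact: (C_space_bounded (f - g)). Qed.

Lemma C_space_ex (g : K -> R) : continuous g ->
  exists f : C_space R cK, forall x, f x = g x.
Proof. by move=> cg; exists (CSpace cK (mem_set cg)). Qed.

Lemma C_space_min_maximal_equilateral (S : set K) : hausdorff_space K ->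
  infinite_set S -> S `<=` isolated [set: K] ->
  (exists! p : K, limit_point S p) ->
  min_maximal_equilateral (C_space R cK) [set: nat].
Proof.
move=> hK Sinf Siso [p [_ pS]]; have evM := C_space_sup_metric.
have [s sI sS] := infinite_set_injection Sinf.
have [r rs] := partial_inverse sI.
have /choice[f fE] : forall n, exists f : C_space R cK,
    forall x, f x = oapp (word n) (word_tail n) (r x).
  move=> n; apply: C_space_ex.
  (* The exceptional points are s_0, ..., s_n, with s_n included because the deviation sits
     there. *)
  apply: (@continuous_off_isolated _ _ (s @` `I_n.+1) _ (word_tail n) hK).
  - exact/finite_image/finite_II.
  - by move=> _ [i _ <-]; exact: Siso.
  - move=> x nx; case rx : (r x) => [i|] //=; apply: word_gtn.
    by rewrite ltnNge; apply/negP => ni; apply: nx; exists i => //; exact/esym/rs.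
apply: (@min_maximal_equilateral_nat _ _ (range f)).
- move=> B; apply: (maximal_equilateral_infinite (0 : C_space R cK) evM Sinf) => g y c Sy.
  have [d dE] : exists d : C_space R cK,
      forall x, d x = if `[< x = y >] then c else 0.
    apply/C_space_ex/(@continuous_off_isolated _ _ [set y] _ 0 hK) => //.
      by move=> _ ->; exact: Siso.
    by move=> x xy; case: asboolP.
  exists (g - d); split=> [|x xy].
    by transitivity (g y - d y); rewrite // dE; case: asboolP.
  by transitivity (g x - d x); rewrite // dE; case: asboolP => // _; rewrite subr0.
- apply: maximal_equilateral_unit.
  + exists (f 0%N), (f 1%N); split; [by exists 0%N|by exists 1%N|] => f01.
    have := mdist_word evM rs fE (@n_Sn 0).
    by rewrite f01 mdistxx => /eqP; rewrite eq_sym oner_eq0.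
  + move=> _ _ [m _ <-] [n _ <-] mn.
    by apply: (mdist_word evM rs fE) => mnE; apply: mn; rewrite mnE.
  + move=> h hA; have hf n : mdist h (f n) = 1 by apply: hA; exists n.
    have hs := unit_dist_parity evM rs fE hf.
    (* The even and the odd subsequence each have a limit point by compactness, which must be p by
       uniqueness; continuity then forces h(p) to be both 0 and 1. *)
    have hp (b : bool) : h p = if b then 1 else 0.
      have tI : injective (fun n => s (b + n.*2)%N).
        by move=> m n /sI/addnI/double_inj.
      have [q tq] := compact_limit_point cK tI.
      rewrite (pS q); last by apply: limit_pointS tq => _ [n _ <-].
      apply: (limit_point_cst (@C_space_continuous R K cK h) _ tq) => _ [n _ <-].
      by rewrite hs /parity oddD odd_double addbF; case: b {tI tq}.
    by have := hp true; rewrite (hp false) => /eqP; rewrite eq_sym oner_eq0.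
- exact/card_image_le.
Qed.

End ContinuousFunctions.

Theorem theorem7 (R : realType)
    (Gamma : Type) (Gamma_infinite : infinite_set [set: Gamma])
    (K : topologicalType) (cK : compact [set: K]) (hK : hausdorff_space K)
    (isolated_limit : exists S : set K,
      [/\ infinite_set S, S `<=` isolated [set: K] &
          exists! p : K, limit_point S p]) :
  min_maximal_equilateral (ell_infty R Gamma) [set: nat] /\
  min_maximal_equilateral (C_space R cK) [set: nat].
Proof.
split; first exact: ell_infty_min_maximal_equilateral.
by case: isolated_limit => S [Sinf Siso pS]; exact: C_space_min_maximal_equilateral pS.
Qed.
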